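(* Let $\tau\ge1$ be an integer, and let $m,n,m'$ be integers with $1\le m'\le m-1$, $m'+\tau-1\le m$ and $\tau\le n$. Let $\{z_1^1,\dots,z_{m+1}^1;u_1^1,\dots,u_m^1\}$ be a local optimizer of $\mathcal P_1(z_0';m)$, and let $\{z_1^2,\dots,z_{n+1}^2;u_1^2,\dots,u_n^2\}$ be a local optimizer of $\mathcal P_1(z_{m'+1}^1;n)$ (so $z_1^2=z_{m'+1}^1$). Assume: (a) (Rank) $\partial f/\partial u$ has full column rank at the reference pairs $(z_0',u_0')$ and $(z^1_{m'+1},u^1_{m'})$ of the two planning cycles; and every $\tau$-step reachability matrix $$\mathcal C_i=\left[B_i,\;A_iB_{i-1},\;\cdots,\;A_i\cdots A_{i-\tau+2}B_{i-\tau+1}\right]$$ formed along either of the two optimizers has full row rank $n_z$, where $A_i=\partial f/\partial z$ and $B_i=\partial f/\partial u$ are evaluated at the pair $(z_i,u_i)$ of that optimizer. (b) (MFCQ) Local optimizers of the problems $\mathcal P_1(\cdot\,;\cdot)$ satisfy the Mangasarian–Fromovitz constraint qualification. (c) ${u_i^1}^\top Q_2u_i^1<1$ for $m'\le i\le m'+\tau-1$, and ${u_i^2}^\top Q_2u_i^2<1$ for $1\le i\le\tau$. (d) The corresponding states, including the stitching state $z_{m'+1}^1=z_1^2$, are strictly feasible for the collision and state-bound constraints: $\|z_i^\ell[1:2]-p_j\|>r_j$ for all $1\le j\le n_{obs}$ and $G_1(z_i^\ell)<0$, for $m'+1\le i\le m'+\tau-1$ when $\ell=1$ and for $1\le i\le\tau$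 when $\ell=2$. Then the concatenated sequence $$\{z_1^1,\dots,z_{m'+1}^1,z_2^2,\dots,z_{n+1}^2;\;u_1^1,\dots,u_{m'}^1,u_1^2,\dots,u_n^2\}$$ satisfies the KKT conditions of $\mathcal P_1(z_0';m'+n)$ with the multipliers obtained by concatenating the corresponding multipliers of the two subproblems: if $(\upsilon^\ell,\zeta^\ell,s^\ell,q^\ell)$, $\ell=1,2$, are KKT multipliers of the two optimizers, the concatenated multipliers are $\upsilon=(\upsilon_1^1,\dots,\upsilon_{m'}^1,\upsilon_1^2,\dots,\upsilon_n^2)$, $q=(q_1^1,\dots,q_{m'}^1,q_1^2,\dots,q_n^2)$, $s=(s_1^1,\dots,s_{m'}^1,s_1^2,\dots,s_{n+1}^2)$, and $\zeta_{\cdot j}=(\zeta_{1j}^1,\dots,\zeta_{m'j}^1,\zeta_{1j}^2,\dots,\zeta_{n+1,j}^2)$ for each $j$.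
   Context: Notation: $a[1:2]$ denotes the first two entries of a vector; $\|a\|_Q=\sqrt{a^\top Qa}$. States $z\in\mathbb R^{n_z}$, inputs $u\in\mathbb R^{n_u}$, a differentiable map $f:\mathbb R^{n_z}\times\mathbb R^{n_u}\to\mathbb R^{n_z}$ (discrete dynamics), positive definite matrices $Q_0,Q_1,Q_2$, a target $z_f\in\mathbb R^{n_z}$, obstacle centers $p_j\in\mathbb R^2$ and radii $r_j>0$, $1\le j\le n_{obs}$; $G_1(z)=z^\top Q_1z-1$, $G_2(u)=u^\top Q_2u-1$. The planning cycle with initial state $z_0'$ has an associated reference control $u_0'$, forming its reference pair $(z_0',u_0')$; the second cycle has reference pair $(z_{m'+1}^1,u_{m'}^1)$. Problem $\mathcal P_1(z_0';N)$: over sequences $\{z_1,\dots,z_{N+1};u_1,\dots,u_N\}$ minimize $\|z_{N+1}-z_f\|_{Q_0}^2$ subject to $z_1=z_0'$; $z_{i+1}=f(z_i,u_i)$, $1\le i\le N$; $G_1(z_i)\le0$, $1\le i\le N+1$; $G_2(u_i)\le0$, $1\le i\le N$; $\|z_i[1:2]-p_j\|\ge r_j$, $1\le i\le N+1$, $1\le j\le n_{obs}$. Since $z_1$ is pinned to $z_0'$, it is not regarded as a decision variable. Lagrangian: $$\mathscr L_N=\|z_{N+1}-z_f\|_{Q_0}^2+\sum_{i=1}^N\upsilon_i^\top(z_{i+1}-f(z_i,u_i))+\sum_{i=1}^{N+1}\sum_{j=1}^{n_{obs}}\zeta_{ij}\left(r_j^2-\|z_i[1:2]-p_j\|^2\right)+\sum_{i=1}^{N+1}s_iG_1(z_i)+\sum_{i=1}^Nq_iG_2(u_i).$$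 KKT conditions of $\mathcal P_1(z_0';N)$ with multipliers $(\upsilon,\zeta,s,q)$: primal feasibility; $\partial\mathscr L_N/\partial z_i=0$ for $2\le i\le N+1$ and $\partial\mathscr L_N/\partial u_i=0$ for $1\le i\le N$; $\zeta_{ij}(r_j^2-\|z_i[1:2]-p_j\|^2)=0$ and $s_iG_1(z_i)=0$ for $1\le i\le N+1$ and all $j$; $q_iG_2(u_i)=0$ for $1\le i\le N$; $\zeta_{ij},s_i,q_i\ge0$. Mangasarian–Fromovitz constraint qualification at a point: the gradients of all equality constraints are linearly independent, and there is a vector orthogonal to the gradients of all equality constraints that is a (strict) descent direction for every active inequality constraint. It guarantees that KKT multipliers exist at a local optimizer. *)

(* Defs.v *)
From HB Require Import structures.
From mathcomp Require Import all_boot all_order all_algebra.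
From mathcomp Require Import all_classical all_reals all_analysis.

Set Implicit Arguments.
Unset Strict Implicit.
Unset Printing Implicit Defensive.

Import Order.TTheory GRing.Theory Num.Theory.
Import numFieldNormedType.Exports.

Local Open Scope classical_set_scope.
Local Open Scope ring_scope.

Definition inner (R : realType) (n : nat) (a b : 'cV[R]_n) : R :=
  (a^T *m b) 0 0.

Definition quad (R : realType) (n : nat) (Q : 'M[R]_n) (a : 'cV[R]_n) : R :=
  (a^T *m Q *m a) 0 0.

Definition qnorm (R : realType) (n : nat) (Q : 'M[R]_n) (a : 'cV[R]_n) : R :=
  Num.sqrt (quad Q a).

(* The norm `|a| of MathComp-Analysis on matrices is the sup norm, hence
   a separate Euclidean norm. *)
Definition enorm (R : realType) (n : nat) (a : 'cV[R]_n) : R :=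
  qnorm 1%:M a.

Definition posdef (R : realType) (n : nat) (Q : 'M[R]_n) : Prop :=
  Q^T = Q /\ (forall a : 'cV[R]_n, a != 0 -> 0 < quad Q a).

Definition grad (R : realType) (n : nat) (g : 'cV[R]_n -> R) (x : 'cV[R]_n) :
    'cV[R]_n :=
  \col_(k < n) 'D_(delta_mx k 0) g x.

(* Column-vector convention; the library's ['J g x] is the transpose, for maps
   between row vectors. *)
Definition jac (R : realType) (m n : nat) (g : 'cV[R]_n -> 'cV[R]_m)
    (x : 'cV[R]_n) : 'M[R]_(m, n) :=
  \matrix_(i < m, k < n) ('D_(delta_mx k 0) g x) i 0.

(* States live in R^(2 + d): forming the position z[1:2] requires a state
   dimension of at least 2, and z[1:2] is then [usubmx z]. *)
Record planning_data (R : realType) (d nu nobs : nat) := PlanningData {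
  dyn : 'cV[R]_(2 + d) * 'cV[R]_nu -> 'cV[R]_(2 + d);
  Q0 : 'M[R]_(2 + d);
  Q1 : 'M[R]_(2 + d);
  Q2 : 'M[R]_nu;
  target : 'cV[R]_(2 + d);
  obs_center : 'I_nobs -> 'cV[R]_2;
  obs_radius : 'I_nobs -> R
}.

(* Finite sequences are functions on nat read with 1-based indices: with horizon
   N, only z_1, ..., z_(N+1) and u_1, ..., u_N (and the multipliers in the ranges
   of the Lagrangian) are meaningful; all other values are ignored. *)
Record multipliers (R : realType) (d nobs : nat) := Multipliers {
  mu_dyn : nat -> 'cV[R]_(2 + d);
  mu_obs : nat -> 'I_nobs -> R;
  mu_state : nat -> R;
  mu_ctrl : nat -> R
}.

Section Planning.
Variables (R : realType) (d nu nobs : nat).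
Variable P : planning_data R d nu nobs.

Notation state := 'cV[R]_(2 + d).
Notation ctrl := 'cV[R]_nu.
Implicit Types (z : nat -> state) (u : nat -> ctrl) (N : nat).

Definition G1 (x : state) : R := quad (Q1 P) x - 1.
Definition G2 (v : ctrl) : R := quad (Q2 P) v - 1.

Definition obs_dist (j : 'I_nobs) (x : state) : R :=
  enorm (usubmx x - obs_center P j).
Definition obs (j : 'I_nobs) (x : state) : R :=
  obs_radius P j ^+ 2 - obs_dist j x ^+ 2.

Definition dfdz (x : state) (v : ctrl) : 'M[R]_(2 + d) :=
  jac (fun y => dyn P (y, v)) x.
Definition dfdu (x : state) (v : ctrl) : 'M[R]_(2 + d, nu) :=
  jac (fun w => dyn P (x, w)) v.

(* [reach tau z u i] = [B_i, A_i B_(i-1), ..., A_i ... A_(i-tau+2) B_(i-tau+1)];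
   block k (0 <= k < tau) is A_i A_(i-1) ... A_(i-k+1) B_(i-k). *)
Definition reach (tau : nat) z u (i : nat) :
    'M[R]_(2 + d, \sum_(k < tau) nu) :=
  \mxrow_(k < tau)
    ((\big[mulmx/1%:M]_(0 <= l < k) dfdz (z (i - l)%N) (u (i - l)%N))
       *m dfdu (z (i - k)%N) (u (i - k)%N)).

Definition cost N z : R := qnorm (Q0 P) (z N.+1 - target P) ^+ 2.

Definition feasible (z0 : state) N z u : Prop :=
  [/\ z 1%N = z0,
      forall i : nat, (1 <= i <= N)%N -> z i.+1 = dyn P (z i, u i),
      forall i : nat, (1 <= i <= N.+1)%N -> G1 (z i) <= 0,
      forall i : nat, (1 <= i <= N)%N -> G2 (u i) <= 0 &
      forall (i : nat) (j : 'I_nobs),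
        (1 <= i <= N.+1)%N -> obs_radius P j <= obs_dist j (z i)].

Definition local_optimizer (z0 : state) N z u : Prop :=
  feasible z0 N z u /\
  exists2 e : R, 0 < e &
    forall (z' : nat -> state) (u' : nat -> ctrl),
      feasible z0 N z' u' ->
      (forall i : nat, (1 <= i <= N.+1)%N -> `|z' i - z i| < e) ->
      (forall i : nat, (1 <= i <= N)%N -> `|u' i - u i| < e) ->
      cost N z <= cost N z'.

Definition upd (T : Type) (a : nat -> T) (i : nat) (x : T) : nat -> T :=
  fun k => if k == i then x else a k.

(* Partial gradients with respect to z_i and u_i of a function of the whole
   sequence; the gradient with respect to the decision variables is the family of
   these blocks, for z_2, ..., z_(N+1) and u_1, ..., u_N (z_1 is pinned). *)
Definition gradz (c : (nat -> state) -> (nat -> ctrl) -> R) z u (i : nat) :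
    state :=
  grad (fun x => c (upd z i x) u) (z i).
Definition gradu (c : (nat -> state) -> (nat -> ctrl) -> R) z u (i : nat) :
    ctrl :=
  grad (fun v => c z (upd u i v)) (u i).

Definition slope N (c : (nat -> state) -> (nat -> ctrl) -> R) z u
    (dz : nat -> state) (du : nat -> ctrl) : R :=
  \sum_(2 <= i < N.+2) inner (gradz c z u i) (dz i) +
  \sum_(1 <= i < N.+1) inner (gradu c z u i) (du i).

Definition lagrangian N (mu : multipliers R d nobs) z u : R :=
  cost N z
  + \sum_(1 <= i < N.+1) inner (mu_dyn mu i) (z i.+1 - dyn P (z i, u i))
  + \sum_(1 <= i < N.+2) \sum_(j < nobs) mu_obs mu i j * obs j (z i)
  + \sum_(1 <= i < N.+2) mu_state mu i * G1 (z i)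
  + \sum_(1 <= i < N.+1) mu_ctrl mu i * G2 (u i).

Definition KKT (z0 : state) N z u (mu : multipliers R d nobs) : Prop :=
  [/\ feasible z0 N z u,
      (forall i : nat, (2 <= i <= N.+1)%N -> gradz (lagrangian N mu) z u i = 0)
      /\ (forall i : nat, (1 <= i <= N)%N -> gradu (lagrangian N mu) z u i = 0),
      forall i : nat, (1 <= i <= N.+1)%N ->
        (forall j : 'I_nobs, mu_obs mu i j * obs j (z i) = 0)
        /\ mu_state mu i * G1 (z i) = 0,
      forall i : nat, (1 <= i <= N)%N -> mu_ctrl mu i * G2 (u i) = 0 &
      (forall i : nat, (1 <= i <= N.+1)%N ->
        (forall j : 'I_nobs, 0 <= mu_obs mu i j) /\ 0 <= mu_state mu i)
      /\ (forall i : nat, (1 <= i <= N)%N -> 0 <= mu_ctrl mu i)].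

Definition dyn_constraint (i : nat) (k : 'I_(2 + d)) z u : R :=
  (z i.+1 - dyn P (z i, u i)) k 0.

(* As z_1 is not a decision variable, the inequality constraints at i = 1 (which
   do not depend on any decision variable) are not constraints of the program in
   the sense of the constraint qualification. *)
Definition MFCQ N z u : Prop :=
  (forall lam : nat -> state,
    (forall l : nat, (2 <= l <= N.+1)%N ->
      \sum_(1 <= i < N.+1) \sum_(k < 2 + d)
        lam i k 0 *: gradz (dyn_constraint i k) z u l = 0) ->
    (forall l : nat, (1 <= l <= N)%N ->
      \sum_(1 <= i < N.+1) \sum_(k < 2 + d)
        lam i k 0 *: gradu (dyn_constraint i k) z u l = 0) ->
    forall i : nat, (1 <= i <= N)%N -> lam i = 0)
  /\
  exists (dz : nat -> state) (du : nat -> ctrl),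
    [/\ forall (i : nat) (k : 'I_(2 + d)), (1 <= i <= N)%N ->
          slope N (dyn_constraint i k) z u dz du = 0,
        forall (i : nat) (j : 'I_nobs), (2 <= i <= N.+1)%N ->
          obs j (z i) = 0 ->
          slope N (fun z' _ => obs j (z' i)) z u dz du < 0,
        forall i : nat, (2 <= i <= N.+1)%N -> G1 (z i) = 0 ->
          slope N (fun z' _ => G1 (z' i)) z u dz du < 0 &
        forall i : nat, (1 <= i <= N)%N -> G2 (u i) = 0 ->
          slope N (fun _ u' => G2 (u' i)) z u dz du < 0].

End Planning.

(* [splice k m' a b] = (a_1, ..., a_k, b_(k-m'+1), b_(k-m'+2), ...). *)
Definition splice (T : Type) (k m' : nat) (a b : nat -> T) : nat -> T :=
  fun i => if (i <= k)%N then a i else b (i - m')%N.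

(* The stitched states keep z^1_1, ..., z^1_(m'+1) and continue with z^2_2. *)
Definition concat_states (T : Type) (m' : nat) (z1 z2 : nat -> T) : nat -> T :=
  splice m'.+1 m' z1 z2.

(* Controls and multipliers keep a_1, ..., a_m' and continue with b_1. *)
Definition concat_seq (T : Type) (m' : nat) (a b : nat -> T) : nat -> T :=
  splice m' m' a b.

Definition concat_multipliers (R : realType) (d nobs : nat) (m' : nat)
    (mu1 mu2 : multipliers R d nobs) : multipliers R d nobs :=
  Multipliers
    (concat_seq m' (mu_dyn mu1) (mu_dyn mu2))
    (concat_seq m' (mu_obs mu1) (mu_obs mu2))
    (concat_seq m' (mu_state mu1) (mu_state mu2))
    (concat_seq m' (mu_ctrl mu1) (mu_ctrl mu2)).

(* Main.v *)
(* The costates of each cycle vanish at the stitching point: as long as the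
   state and control bounds are inactive, the stationarity conditions read
   B_i^T v_i = 0 and v_(i-1) = A_i^T v_i, so tau consecutive steps give
   C_i^T v_i = 0 for the reachability matrix C_i, which has full row rank.
   Hence the stationarity condition at the stitching state of the concatenated
   trajectory is trivial, and all the other KKT conditions are those of one of
   the two cycles.

   As z_1 is pinned, the dynamics determine the states from the controls, so
   multipliers exist without an implicit function theorem: along the rollout of
   u + t du, no direction can strictly decrease the cost and all active
   constraints, Gordan's alternative gives multipliers of the inequalities, MFCQ
   makes that of the cost positive, and the costates solve the adjoint
   recursion. *)
Require Import Defs.
From HB Require Import structures.
From mathcomp Require Import all_boot all_order all_algebra.
From mathcomp Require Import all_classical all_reals all_analysis.
From mathcomp Require Import ring lra zify.
Import Order.TTheory GRing.Theory Num.Theory.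
Import numFieldNormedType.Exports.
Local Open Scope classical_set_scope.
Local Open Scope ring_scope.
Set Implicit Arguments.
Unset Strict Implicit.
Unset Printing Implicit Defensive.

(** * Gordan's alternative on a linear subspace *)

(* By induction on [s]: if the strict solution for the tail fails at the head [k],
   split on the tail restricted to the kernel of [l k]. *)
Lemma gordan_alternative (F : realFieldType) (V : lmodType F) (I : eqType)
    (l : I -> V -> F) (s : seq I) (W : V -> Prop) :
  uniq s -> W 0 ->
  (forall a u v, W u -> W v -> W (a *: u + v)) ->
  (forall i a u v, l i (a *: u + v) = a * l i u + l i v) ->
  (exists2 v, W v & {in s, forall i, l i v < 0}) \/
  exists lam : I -> F,
    [/\ forall i, 0 <= lam i, exists2 i, i \in s & 0 < lam i &
        forall v, W v -> \sum_(i <- s) lam i * l i v = 0].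
Proof.
move=> us W0 WP lP.
have l0 i : l i 0 = 0 by have := lP i 1 0 0; rewrite scale1r addr0; lra.
have lZ i a v : l i (a *: v) = a * l i v.
  by have := lP i a v 0; rewrite addr0 l0 addr0.
elim: s us W W0 WP => [_ W W0 _|k s IH /= /andP[ks us] W W0 WP].
  by left; exists 0.
(* Since [k] does not occur in [s], the weight of the head can be reset without touching the sum
   over the tail. *)
have tailE (lam : I -> F) c v :
    \sum_(i <- k :: s) (if i == k then c else lam i) * l i v =
    c * l k v + \sum_(i <- s) lam i * l i v.
  rewrite big_cons eqxx; congr (_ + _); apply: eq_big_seq => i si.
  by case: eqP => // ik; rewrite -ik si in ks.
case: (IH us W W0 WP) => [[v Wv lv]|[lam [lam0 [i si li] lamE]]]; last first.
  right; exists (fun i => if i == k then 0 else lam i); split.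
  - by move=> j; case: ifP.
  - exists i; first by rewrite inE si orbT.
    by case: eqP => // ik; rewrite -ik si in ks.
  - by move=> v Wv; rewrite tailE mul0r add0r lamE.
have [lkv|lkv] := ltP (l k v) 0.
  left; exists v => // i; rewrite inE => /predU1P[->//|]; exact: lv.
(* If [l k] vanishes on all of [W], weight 1 on [k] alone settles the second alternative. Otherwise
   [w] is a direction transversal to its kernel. *)
have [[w Ww lkw]|kerW] := pselect (exists2 w, W w & l k w != 0); last first.
  right; exists (fun i => if i == k then 1 else 0); split.
  - by move=> j; case: ifP.
  - by exists k; rewrite ?mem_head// eqxx.
  - move=> w Ww; rewrite (tailE (fun=> 0)) big1 ?addr0; last first.
      by move=> i _; rewrite mul0r.
    by rewrite mul1r; apply/eqP/negP => /negP lkw; apply: kerW; exists w.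
pose W' u := W u /\ l k u = 0.
have W'0 : W' 0 by split.
have W'P a u1 u2 : W' u1 -> W' u2 -> W' (a *: u1 + u2).
  by move=> [? e1] [? e2]; split; [exact: WP|rewrite lP e1 e2 mulr0 addr0].
case: (IH us W' W'0 W'P) => [[v' [Wv' lkv'] lv']|[lam [lam0 [i si li] lamE]]].
  left.
  (* Normalised so that [l k (c *: w) = -1]. As [l k v' = 0], adding a small positive multiple of
     [c *: w] to [v'] makes the head negative, and smallness keeps the tail negative. *)
  pose c := - (l k w)^-1.
  have lc : l k (c *: w) = -1 by rewrite lZ /c mulNr mulVf.
  have [e e0 eP] : exists2 e : F, 0 < e &
      {in s, forall i, e * l i (c *: w) + l i v' < 0}.
    elim: s lv' {IH us ks tailE lv W'P W'0} => [|i s IHs] lv'.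
      by exists 1.
    have [|e e0 eP] := IHs.
      by move=> j sj; apply: lv'; rewrite inE sj orbT.
    have lvi : l i v' < 0 by apply: lv'; rewrite mem_head.
    (* The added 1 makes the division by [x] legitimate and the resulting inequality strict. *)
    pose x := `|l i (c *: w)| + 1.
    have x0 : 0 < x by rewrite /x ltr_pwDr.
    exists (Num.min e (- l i v' / x)).
      by rewrite lt_min e0 divr_gt0// oppr_gt0.
    have le1 : Num.min e (- l i v' / x) <= e by rewrite ge_min lexx.
    have le2 : Num.min e (- l i v' / x) * x <= - l i v'.
      by rewrite -ler_pdivlMr// ge_min lexx orbT.
    have m0 : 0 < Num.min e (- l i v' / x).
      by rewrite lt_min e0 divr_gt0// oppr_gt0.
    move: (Num.min _ _) le1 le2 m0 => y le1 le2 m0 j.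
    rewrite inE => /predU1P[->|sj].
      have := ler_norm (l i (c *: w)); rewrite /x in le2 *; nra.
    have := eP _ sj.
    have : l j v' < 0 by apply: lv'; rewrite inE sj orbT.
    nra.
  exists (e *: (c *: w) + v').
    by apply: (WP) => //; have := WP c w 0 Ww W0; rewrite addr0.
  move=> i; rewrite inE => /predU1P[->|si]; rewrite lP; last exact: eP.
  by rewrite lc lkv' addr0 mulrN1 oppr_lt0.
right.
(* On [W], the tail combination [S] vanishes wherever [l k] does, so it equals [c * l k]. From
   [S v < 0 <= l k v] follows [c <= 0], and [- c] serves as the weight of the head. *)
pose S u := \sum_(i <- s) lam i * l i u.
have SP a u1 u2 : S (a *: u1 + u2) = a * S u1 + S u2.
  rewrite /S mulr_sumr -big_split; apply: eq_bigr => j _ /=.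
  by rewrite lP; ring.
have Sv : S v < 0.
  rewrite /S (perm_big _ (perm_to_rem si)) big_cons /=.
  rewrite ltr_wnDr ?nmulr_llt0 ?pmulr_rlt0 ?lv//.
  rewrite big_seq; apply: sumr_le0 => j sj.
  by rewrite mulr_ge0_le0// ltW// lv//; apply: mem_rem sj.
pose c := S w / l k w.
have Sc u : W u -> S u = c * l k u.
  move=> Wu; have : W' (- (l k u / l k w) *: w + u).
    split; first exact: WP.
    by rewrite lP mulNr divfK// addNr.
  move/lamE; rewrite -/(S _) SP /c => /eqP.
  by rewrite mulNr addrC subr_eq0 => /eqP ->; field.
have c0 : 0 <= - c.
  rewrite oppr_ge0 leNgt; apply/negP => c0.
  by move: Sv; rewrite Sc// ltNge mulr_ge0// ltW.
exists (fun i => if i == k then - c else lam i); split.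
- by move=> j; case: ifP.
- exists i; first by rewrite inE si orbT.
  by case: eqP => // ik; rewrite -ik si in ks.
- by move=> u Wu; rewrite tailE -/(S u) Sc// mulNr addNr.
Qed.

(** * Algebra of the Euclidean inner product *)

Section Inner.
Variables (R : realType) (n : nat).
Implicit Types a b v : 'cV[R]_n.

Lemma innerE a b : inner a b = \sum_(k < n) a k 0 * b k 0.
Proof. by rewrite /inner mxE; apply: eq_bigr => k _; rewrite mxE. Qed.

Lemma innerC a b : inner a b = inner b a.
Proof. by rewrite !innerE; apply: eq_bigr => k _; rewrite mulrC. Qed.

Lemma innerDr a b v : inner a (b + v) = inner a b + inner a v.
Proof. by rewrite /inner mulmxDr mxE. Qed.

Lemma innerZr a k v : inner a (k *: v) = k * inner a v.
Proof. by rewrite /inner -scalemxAr mxE. Qed.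

Lemma innerNr a v : inner a (- v) = - inner a v.
Proof. by rewrite /inner mulmxN mxE. Qed.

Lemma innerDl a b v : inner (a + b) v = inner a v + inner b v.
Proof. by rewrite innerC innerDr !(innerC v). Qed.

Lemma innerZl k a v : inner (k *: a) v = k * inner a v.
Proof. by rewrite innerC innerZr innerC. Qed.

Lemma innerNl a v : inner (- a) v = - inner a v.
Proof. by rewrite innerC innerNr innerC. Qed.

Lemma inner0l v : inner 0 v = 0.
Proof. by rewrite -(scale0r 0) innerZl mul0r. Qed.

Lemma inner0r v : inner v 0 = 0.
Proof. by rewrite innerC inner0l. Qed.

Lemma inner_suml (I : Type) (s : seq I) (F : I -> 'cV[R]_n) v :
  inner (\sum_(i <- s) F i) v = \sum_(i <- s) inner (F i) v.
Proof.
elim: s => [|i s IH]; first by rewrite !big_nil inner0l.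
by rewrite !big_cons innerDl IH.
Qed.

Lemma inner_deltar a k : inner a (delta_mx k 0) = a k 0.
Proof.
rewrite innerE (bigD1 k)//= big1 ?addr0; first by rewrite mxE !eqxx mulr1.
by move=> j /negPf jk; rewrite mxE jk mulr0.
Qed.

Lemma inner_ge0 a : 0 <= inner a a.
Proof. by rewrite innerE sumr_ge0// => k _; rewrite -expr2 sqr_ge0. Qed.

Lemma inner_eq0 a : inner a a = 0 -> a = 0.
Proof.
rewrite innerE => /eqP; rewrite psumr_eq0 => [/allP a0|k _]; last first.
  by rewrite -expr2 sqr_ge0.
apply/colP => k; rewrite mxE; apply/eqP.
by have := a0 k (mem_index_enum _); rewrite /= mulf_eq0 orbb.
Qed.

End Inner.

Lemma inner_mulmx (R : realType) (m n : nat) (M : 'M[R]_(m, n)) a b :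
  inner a (M *m b) = inner (M^T *m a) b.
Proof. by rewrite /inner trmx_mul trmxK mulmxA. Qed.

Lemma cV_sum_delta (R : realType) (n : nat) (v : 'cV[R]_n) :
  v = \sum_(k < n) v k 0 *: delta_mx k 0.
Proof.
apply/colP => k; rewrite summxE (bigD1 k)//= big1 ?addr0.
  by rewrite !mxE !eqxx mulr1.
by move=> j /negPf jk; rewrite !mxE eq_sym jk mulr0.
Qed.

(** * Gradients as representers of differentials *)

Section Gradient.
Variables (R : realType) (n : nat).
Implicit Types (g : 'cV[R]_n -> R) (x G : 'cV[R]_n).

(** Gradients are computed in the form [is_diff x g (inner G)], which is stable under sums and the
    chain rule. This lemma reads off [grad] at the end, and [is_diff_grad] goes back. *)
Lemma grad_is_diff g x G : is_diff x g (inner G) -> grad g x = G.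
Proof.
move=> dg; apply/colP => k; rewrite mxE deriveE; last exact: ex_diff.
by rewrite diff_val inner_deltar.
Qed.

Lemma is_diff_grad g x : differentiable g x -> is_diff x g (inner (grad g x)).
Proof.
move=> dg; apply: DiffDef => //; apply/funext => v.
rewrite {1}(cV_sum_delta v) linear_sum innerE /=; apply: eq_bigr => k _.
by rewrite linearZ mulrC mxE deriveE.
Qed.

End Gradient.

Lemma is_diff_jac (R : realType) (m n : nat) (g : 'cV[R]_n -> 'cV[R]_m) x :
  differentiable g x -> is_diff x g (fun v => jac g x *m v).
Proof.
move=> dg; apply: DiffDef => //; apply/funext => v.
rewrite {1}(cV_sum_delta v) linear_sum.
apply/colP => i; rewrite summxE mxE; apply: eq_bigr => k _.
by rewrite linearZ !mxE deriveE// mulrC.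
Qed.

Lemma differentiable_quad (R : realType) (n : nat) (Q : 'M[R]_n) x :
  differentiable (quad Q) x.
Proof.
have -> : quad Q = \sum_(j < n) \sum_(i < n)
    (Q i j *: ((fun a : 'cV[R]_n => a i 0) * (fun a : 'cV[R]_n => a j 0))).
  apply/funext => a; rewrite /quad mxE !fct_sumE; apply: eq_bigr => j _.
  rewrite fct_sumE mxE mulr_suml; apply: eq_bigr => i _.
  by rewrite mxE -[RHS]/(Q i j * (a i 0 * a j 0)); ring.
apply: differentiable_sum => j; apply: differentiable_sum => i.
by apply: differentiableZ; apply: differentiableM; exact: differentiable_coord.
Qed.

(** The two cases are those of an inactive and of an active constraint along a curve: continuity
    settles the first, the sign of the limit of the difference quotient the second. *)
Lemma right_near_lt0 (R : realType) (g : R -> R) (a : R) :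
  is_diff (0 : R) g ( *:%R^~ a) -> g 0 < 0 \/ g 0 = 0 /\ a < 0 ->
  \forall t \near (0 : R)^'+, g t < 0.
Proof.
move=> dg [g0|[g0 a0]].
  have /differentiable_continuous gc : differentiable g (0 : R).
    exact: ex_diff.
  have gr : g t @[t --> (0 : R)^'+] --> g 0.
    by apply: cvg_at_right_filter; exact: gc.
  exact: (gr _ (lt_nbhsl g0)).
have /derivable1_diffP gd : differentiable g (0 : R) by exact: ex_diff.
have ga : derive1 g 0 = a.
  by rewrite derive1E' ?diff_val ?scale1r//; exact: ex_diff.
have : h^-1 * g h @[h --> (0 : R)^'] --> a.
  rewrite -ga derive1E.
  have -> : (fun h : R => h^-1 * g h) =
      (fun h : R => h^-1 *: ((g \o shift 0) (h *: (1 : R)) - g 0)).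
    by apply/funext => h /=; rewrite g0 subr0 addr0 scaler1.
  exact: gd.
move=> /cvg_dnbhs_at_right gr.
near=> t.
have t0 : 0 < t by near: t; exact: nbhs_right_gt.
have : t^-1 * g t < 0 by near: t; exact: (gr _ (lt_nbhsl a0)).
by rewrite pmulr_rlt0 // invr_gt0.
Unshelve. all: by end_near.
Qed.

Section GradientCalculus.
Variables (R : realType) (n : nat).
Implicit Types (g h : 'cV[R]_n -> R) (x G H : 'cV[R]_n).

Lemma is_diff_inner (a x : 'cV[R]_n) : is_diff x (inner a) (inner a).
Proof.
have ia : differentiable (inner a) x.
  have -> : inner a = \sum_(k < n) (a k 0 *: (fun y : 'cV[R]_n => y k 0)).
    by apply/funext => y; rewrite innerE fct_sumE.
  apply: differentiable_sum => k; apply: differentiableZ.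
  exact: differentiable_coord.
have ga : grad (inner a) x = a.
  apply/colP => k; rewrite mxE -[RHS]inner_deltar /derive.
  (* The difference quotient of a linear form does not depend on the nonzero increment. *)
  apply: lim_near_cst => //.
  near=> h => /=.
  rewrite innerDr innerZr addrK -[_ *: _]/(_ * _) mulrA mulVf ?mul1r//.
  near: h; exact: nbhs_dnbhs_neq.
by rewrite -{2}ga; exact: is_diff_grad.
Unshelve. all: by end_near.
Qed.

Lemma is_grad_cst (c : R) x : is_diff x (fun=> c) (inner 0).
Proof.
by apply: is_diff_eq (is_diff_cst c x) _; apply/funext => v; rewrite inner0l.
Qed.

Lemma is_gradD g h x G H : is_diff x g (inner G) -> is_diff x h (inner H) ->
  is_diff x (fun y => g y + h y) (inner (G + H)).
Proof.
move=> dg dh; apply: is_diff_eq (is_diffD dg dh) _.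
by apply/funext => v; rewrite innerDl.
Qed.

Lemma is_gradZ (c : R) g x G : is_diff x g (inner G) ->
  is_diff x (fun y => c * g y) (inner (c *: G)).
Proof.
move=> dg; apply: is_diff_eq (is_diffZ c dg) _.
by apply/funext => v; rewrite innerZl.
Qed.

Lemma is_grad_sum (I : Type) (s : seq I) (g : I -> 'cV[R]_n -> R) x
    (G : I -> 'cV[R]_n) :
  (forall i, is_diff x (g i) (inner (G i))) ->
  is_diff x (fun y => \sum_(i <- s) g i y) (inner (\sum_(i <- s) G i)).
Proof.
move=> dg; elim: s => [|i s IH].
  rewrite big_nil; under eq_fun do rewrite big_nil; exact: is_grad_cst.
rewrite big_cons; under eq_fun do rewrite big_cons; exact: is_gradD.
Qed.

End GradientCalculus.

(** * Kronecker sums, squared norms and updated sequences *)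

(** Differentiating a sum over the horizon in one variable produces a Kronecker factor in each term;
    this collapses the sum to the single surviving term, if it is in range. *)
Lemma sum_eq_nat (R : nzRingType) (V : lmodType R) (F : nat -> V)
    (m n l : nat) :
  \sum_(m <= i < n) (l == i)%:R *: F i = (m <= l < n)%:R *: F l.
Proof.
have -> : (m <= l < n)%:R *: F l = if (m <= l < n)%N then F l else 0.
  by case: ifP; rewrite ?scale1r ?scale0r.
rewrite -(@big_nat1_eq _ _ +%R) [RHS]big_mkcond; apply: eq_bigr => i _.
by rewrite eq_sym; case: eqP => _; rewrite ?scale1r ?scale0r.
Qed.

Lemma quad1 (R : realType) (n : nat) (a : 'cV[R]_n) : quad 1%:M a = inner a a.
Proof. by rewrite /quad mulmx1. Qed.

Lemma sqr_qnorm (R : realType) (n : nat) (Q : 'M[R]_n) a :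
  posdef Q -> qnorm Q a ^+ 2 = quad Q a.
Proof.
move=> [_ Q0]; rewrite sqr_sqrtr//; have [->|/Q0/ltW//] := eqVneq a 0.
by rewrite /quad mulmx0 mxE.
Qed.

Lemma sqr_enorm (R : realType) (n : nat) (a : 'cV[R]_n) :
  enorm a ^+ 2 = inner a a.
Proof. by rewrite sqr_sqrtr quad1 ?inner_ge0. Qed.

Lemma upd_same (T : Type) (a : nat -> T) i k : upd a i (a i) k = a k.
Proof. by rewrite /upd; case: eqP => [->|]. Qed.

Lemma is_diff_upd (R : realType) (n : nat) (z : nat -> 'cV[R]_n) (l k : nat) x :
  is_diff x (fun y => upd z l y k) (fun v => (l == k)%:R *: v).
Proof.
rewrite /upd eq_sym; case: eqP => _.
  by apply: is_diff_eq (is_diff_id x) _; apply/funext => v; rewrite scale1r.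
apply: is_diff_eq (is_diff_cst (z k) x) _.
by apply/funext => v; rewrite scale0r.
Qed.

(** * Derivatives of the planning data and of the Lagrangian *)

Section Planning.
Variables (R : realType) (d nu nobs : nat).
Variable P : planning_data R d nu nobs.
Hypothesis hf : forall w : 'cV[R]_(2 + d) * 'cV[R]_nu, differentiable (dyn P) w.
Hypothesis hQ0 : posdef (Q0 P).

Implicit Types (z : nat -> 'cV[R]_(2 + d)) (u : nat -> 'cV[R]_nu).

Definition terminal_cost (x : 'cV[R]_(2 + d)) : R :=
  qnorm (Q0 P) (x - target P) ^+ 2.

Lemma differentiable_terminal_cost x : differentiable terminal_cost x.
Proof.
have -> : terminal_cost = quad (Q0 P) \o (fun y => y - target P).
  by apply/funext => y /=; rewrite /terminal_cost sqr_qnorm.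
by apply: differentiable_comp => //; exact: differentiable_quad.
Qed.

Lemma differentiable_G1 x : differentiable (G1 P) x.
Proof. by apply: differentiableB; [exact: differentiable_quad|]. Qed.

Lemma differentiable_G2 x : differentiable (G2 P) x.
Proof. by apply: differentiableB; [exact: differentiable_quad|]. Qed.

Lemma obsE j x : obs P j x = obs_radius P j ^+ 2
  - inner (usubmx x - obs_center P j) (usubmx x - obs_center P j).
Proof. by rewrite /obs /obs_dist sqr_enorm. Qed.

Lemma differentiable_obs j x : differentiable (obs P j) x.
Proof.
pose c (k : 'I_2) (y : 'cV[R]_(2 + d)) := y (lshift d k) 0.
have -> : obs P j = cst (obs_radius P j ^+ 2)
    - \sum_(k < 2) ((c k - cst (obs_center P j k 0)) ^+ 2).
  apply/funext => y; rewrite obsE innerE.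
  rewrite -[RHS]/(_ - (\sum_(k < 2) ((c k - cst (obs_center P j k 0)) ^+ 2)) y).
  rewrite fct_sumE; congr (_ - _); apply: eq_bigr => k _.
  by rewrite !mxE expr2.
apply: differentiableB; first exact: differentiable_cst.
apply: differentiable_sum => k; apply: differentiableX; apply: differentiableB.
  exact: differentiable_coord.
exact: differentiable_cst.
Qed.

Lemma differentiable_dyn_state v x :
  differentiable (fun y => dyn P (y, v)) x.
Proof.
by apply: (@differentiable_comp _ _ _ _ (fun y => (y, v)) (dyn P)).
Qed.

Lemma differentiable_dyn_ctrl v x :
  differentiable (fun w => dyn P (x, w)) v.
Proof.
by apply: (@differentiable_comp _ _ _ _ (fun w => (x, w)) (dyn P)).
Qed.

(** The joint differential is the sum of its restrictions to the two factors, and the chain rule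
    through the inclusions [y |-> (y, v)] and [y |-> (x, y)] identifies these with the partial
    Jacobians. *)
Lemma is_diff_dyn x v :
  is_diff (x, v) (dyn P) (fun w => dfdz P x v *m w.1 + dfdu P x v *m w.2).
Proof.
apply: DiffDef => //; apply/funext => -[a b] /=.
have -> : (a, b) = (a, 0) + (0, b) by congr pair; rewrite /= ?addr0 ?add0r.
rewrite linearD; congr (_ + _).
- have da := is_diff_jac (differentiable_dyn_state v x).
  have dc : is_diff x (fun y => (y, v)) (fun y => (y, 0)).
    exact: is_diff_pair (is_diff_id x) (is_diff_cst v x).
  have := is_diff_comp dc (differentiableP (hf (x, v))) => dd.
  have e1 := @diff_val _ _ _ _ _ _ _ da; have e2 := @diff_val _ _ _ _ _ _ _ dd.
  by rewrite -[LHS]/(('d (dyn P) (x, v) \o (fun y => (y, 0))) a) -e2 e1.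
- have da := is_diff_jac (differentiable_dyn_ctrl v x).
  have dc : is_diff v (fun y => (x, y)) (fun y => (0, y)).
    exact: is_diff_pair (is_diff_cst x v) (is_diff_id v).
  have := is_diff_comp dc (differentiableP (hf (x, v))) => dd.
  have e1 := @diff_val _ _ _ _ _ _ _ da; have e2 := @diff_val _ _ _ _ _ _ _ dd.
  by rewrite -[LHS]/(('d (dyn P) (x, v) \o (fun y => (0, y))) b) -e2 e1.
Qed.

Lemma is_grad_upd (n : nat) (g : 'cV[R]_n -> R) (z : nat -> 'cV[R]_n) l k :
  differentiable g (z k) ->
  is_diff (z l) (fun x => g (upd z l x k))
    (inner ((l == k)%:R *: grad g (z k))).
Proof.
move=> dg; have du := is_diff_upd z l k (z l).
have dg' : is_diff (upd z l (z l) k) g (inner (grad g (z k))).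
  by rewrite upd_same; exact: is_diff_grad.
apply: is_diff_eq (is_diff_comp du dg') _.
by apply/funext => v /=; rewrite innerZr innerZl.
Qed.

Definition gap z u (i : nat) : 'cV[R]_(2 + d) := z i.+1 - dyn P (z i, u i).

(** A state enters the dynamics defects twice: as successor when [l = i.+1], and through the
    dynamics when [l = i], where the Jacobian moves to [lam] as a transpose. *)
Lemma is_grad_gapz lam z u i l :
  is_diff (z l) (fun x => inner lam (gap (upd z l x) u i))
    (inner ((l == i.+1)%:R *: lam
            - (l == i)%:R *: ((dfdz P (z i) (u i))^T *m lam))).
Proof.
have d1 := is_diff_upd z l i.+1 (z l).
have d2 := is_diff_upd z l i (z l).
have d3 : is_diff (upd z l (z l) i) (fun y => dyn P (y, u i))
    (fun v => dfdz P (z i) (u i) *m v).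
  by rewrite upd_same; apply: is_diff_jac; exact: differentiable_dyn_state.
have d4 := is_diffB d1 (is_diff_comp d2 d3).
apply: is_diff_eq (is_diff_comp d4 (is_diff_inner lam _)) _.
apply/funext => v.
rewrite innerDl innerNl !innerZl -inner_mulmx -!innerZr -innerNr -innerDr.
by rewrite scalemxAr.
Qed.

Lemma is_grad_gapu lam z u i l :
  is_diff (u l) (fun v => inner lam (gap z (upd u l v) i))
    (inner (- ((l == i)%:R *: ((dfdu P (z i) (u i))^T *m lam)))).
Proof.
have d1 := is_diff_upd u l i (u l).
have d2 : is_diff (upd u l (u l) i) (fun v => dyn P (z i, v))
    (fun v => dfdu P (z i) (u i) *m v).
  by rewrite upd_same; apply: is_diff_jac; exact: differentiable_dyn_ctrl.
have d3 := is_diffB (is_diff_cst (z i.+1) (u l)) (is_diff_comp d1 d2).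
apply: is_diff_eq (is_diff_comp d3 (is_diff_inner lam _)) _.
apply/funext => v.
rewrite -[LHS]/(inner lam (0 - dfdu P (z i) (u i) *m ((l == i)%:R *: v))).
by rewrite sub0r innerNl innerNr innerZl -inner_mulmx -innerZr scalemxAr.
Qed.

(* The part of dL/dz_i that comes from the inequality constraints. *)
Definition state_force (mu : multipliers R d nobs) z i : 'cV[R]_(2 + d) :=
  \sum_(j < nobs) mu_obs mu i j *: grad (obs P j) (z i)
  + mu_state mu i *: grad (G1 P) (z i).

Lemma lagrangianE N mu z u : lagrangian P N mu z u =
  terminal_cost (z N.+1)
  + \sum_(1 <= i < N.+1) inner (mu_dyn mu i) (gap z u i)
  + \sum_(1 <= i < N.+2) \sum_(j < nobs) mu_obs mu i j * obs P j (z i)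
  + \sum_(1 <= i < N.+2) mu_state mu i * G1 P (z i)
  + \sum_(1 <= i < N.+1) mu_ctrl mu i * G2 P (u i).
Proof. by []. Qed.

(** Only the two defects next to [z l] survive. The factor [(l <= N)] drops the second of them at
    the last state, which has no successor; there the terminal cost appears instead. *)
Lemma gradz_lagrangian N mu z u l : (2 <= l <= N.+1)%N ->
  gradz (lagrangian P N mu) z u l =
  (l == N.+1)%:R *: grad terminal_cost (z l)
  + (mu_dyn mu l.-1 -
     (l <= N)%:R *: ((dfdz P (z l) (u l))^T *m mu_dyn mu l))
  + state_force mu z l.
Proof.
move=> lN; apply: grad_is_diff.
have dc := is_grad_upd l (differentiable_terminal_cost (z N.+1)).
have dd := is_grad_sum (index_iota 1 N.+1)
  (fun i => is_grad_gapz (mu_dyn mu i) z u i l).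
have dobs := is_grad_sum (index_iota 1 N.+2) (fun i =>
  is_grad_sum (index_enum 'I_nobs) (fun j => is_gradZ (mu_obs mu i j)
    (is_grad_upd l (differentiable_obs j (z i))))).
have dG1 := is_grad_sum (index_iota 1 N.+2) (fun i =>
  is_gradZ (mu_state mu i) (is_grad_upd l (differentiable_G1 (z i)))).
have dG2 := is_grad_cst (\sum_(1 <= i < N.+1) mu_ctrl mu i * G2 P (u i)) (z l).
have dL := is_gradD (is_gradD (is_gradD (is_gradD dc dd) dobs) dG1) dG2.
under eq_fun do rewrite lagrangianE.
apply: is_diff_eq dL _; congr inner.
rewrite addr0 -addrA; apply: (f_equal2 +%R); first apply: (f_equal2 +%R).
- by case: eqP => [->|]; rewrite ?scale0r.
- rewrite big_split sumrN sum_eq_nat; congr (_ - _ *: _); last first.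
    by congr (_%:R); lia.
  case: l lN {dc dd dobs dG1 dG2} => [|l] lN; first by lia.
  under eq_bigr do rewrite eqSS.
  by rewrite sum_eq_nat (_ : (1 <= l < _)%N) ?scale1r//; lia.
- rewrite /state_force; congr (_ + _).
    under eq_bigr => i _ do under eq_bigr => j _ do
      rewrite scalerA mulrC -scalerA.
    under eq_bigr => i _ do rewrite -scaler_sumr.
    by rewrite sum_eq_nat (_ : (1 <= l < _)%N) ?scale1r//; lia.
  under eq_bigr => i _ do rewrite scalerA mulrC -scalerA.
  by rewrite sum_eq_nat (_ : (1 <= l < _)%N) ?scale1r//; lia.
Qed.

Lemma gradu_lagrangian N mu z u l : (1 <= l <= N)%N ->
  gradu (lagrangian P N mu) z u l =
  mu_ctrl mu l *: grad (G2 P) (u l) - (dfdu P (z l) (u l))^T *m mu_dyn mu l.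
Proof.
move=> lN; apply: grad_is_diff.
have dc := is_grad_cst (terminal_cost (z N.+1)) (u l).
have dd := is_grad_sum (index_iota 1 N.+1)
  (fun i => is_grad_gapu (mu_dyn mu i) z u i l).
have dobs := is_grad_cst
  (\sum_(1 <= i < N.+2) \sum_(j < nobs) mu_obs mu i j * obs P j (z i)) (u l).
have dG1 := is_grad_cst (\sum_(1 <= i < N.+2) mu_state mu i * G1 P (z i)) (u l).
have dG2 := is_grad_sum (index_iota 1 N.+1) (fun i =>
  is_gradZ (mu_ctrl mu i) (is_grad_upd l (differentiable_G2 (u i)))).
have dL := is_gradD (is_gradD (is_gradD (is_gradD dc dd) dobs) dG1) dG2.
under eq_fun do rewrite lagrangianE.
apply: is_diff_eq dL _; congr inner.
rewrite add0r !addr0 sumrN sum_eq_nat addrC.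
under eq_bigr => i _ do rewrite scalerA mulrC -scalerA.
by rewrite sum_eq_nat (_ : (1 <= l < _)%N) ?scale1r//; lia.
Qed.

End Planning.

(** * Backward adjoint recursion *)

(** Summation by parts against the costates turns the functional in the hypothesis into the sum of
    the products of [g i - (B i)^T *m ups i] with [v i]. The controls being free, [v] may be this
    residual itself, and a vanishing sum of squares remains. *)
Lemma adjoint_sequence (R : realType) (p q N : nat) (A : nat -> 'M[R]_p)
    (B : nat -> 'M[R]_(p, q)) (h : nat -> 'cV[R]_p) (g : nat -> 'cV[R]_q) :
  (forall (x : nat -> 'cV[R]_p) (v : nat -> 'cV[R]_q), x 1%N = 0 ->
    (forall i, (1 <= i <= N)%N -> x i.+1 = A i *m x i + B i *m v i) ->
    \sum_(2 <= i < N.+2) inner (h i) (x i)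
    + \sum_(1 <= i < N.+1) inner (g i) (v i) = 0) ->
  exists ups : nat -> 'cV[R]_p,
    [/\ ups N = - h N.+1,
        forall i, (2 <= i <= N)%N -> ups i.-1 = (A i)^T *m ups i - h i &
        forall i, (1 <= i <= N)%N -> g i = (B i)^T *m ups i].
Proof.
move=> H.
(* Time runs backwards here: [w k] is the costate of index [N - k]. *)
pose fix w k := if k is k'.+1
  then (A (N - k')%N)^T *m w k' - h (N - k')%N else - h N.+1.
pose ups i := w (N - i)%N.
have upsN : ups N = - h N.+1 by rewrite /ups subnn.
have upsS i : (2 <= i <= N)%N -> ups i.-1 = (A i)^T *m ups i - h i.
  move=> iN; rewrite /ups (_ : N - i.-1 = (N - i).+1)%N; last by lia.
  by rewrite /= subKn//; lia.
exists ups; split => //.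
have [N0|N0] := posnP N; first by move=> i; lia.
pose v i := g i - (B i)^T *m ups i.
(* The trajectory driven by [v], shifted by one: [y k] is the state of index [k.+1]. *)
pose fix y k := if k is k'.+1 then A k *m y k' + B k *m v k else 0.
pose x i := y i.-1.
have xS i : (1 <= i <= N)%N -> x i.+1 = A i *m x i + B i *m v i.
  by case: i.
(* Telescoped form of the duality between the costate recursion and the state recursion. *)
have ux M : (M <= N)%N -> inner (ups M) (x M.+1) =
    \sum_(2 <= i < M.+1) inner (h i) (x i)
    + \sum_(1 <= i < M.+1) inner ((B i)^T *m ups i) (v i).
  elim: M => [_|M IH MN]; first by rewrite !big_geq// inner0r addr0.
  rewrite xS// innerDr !inner_mulmx [in RHS](big_nat_recr M.+1 1)//=.
  rewrite addrA; congr (_ + _).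
  case: M IH MN => [_ _|M IH MN]; first by rewrite !big_geq// addr0 inner0r.
  rewrite big_nat_recr//= addrAC -IH; last by lia.
  by rewrite -innerDl (upsS M.+2) ?subrK//; lia.
have := ux N (leqnn N); rewrite upsN innerNl => e1.
have := H x v erefl xS; rewrite (big_nat_recr N.+1)//= => e2.
have e3 : \sum_(1 <= i < N.+1) inner (v i) (v i) = 0.
  rewrite [X in X = _](_ : _ = \sum_(1 <= i < N.+1) inner (g i) (v i)
      - \sum_(1 <= i < N.+1) inner ((B i)^T *m ups i) (v i)); first by lra.
  rewrite -sumrB; apply: eq_bigr => i _.
  by rewrite {1}/v innerDl innerNl.
move=> i iN; apply/eqP; rewrite -subr_eq0; apply/eqP/inner_eq0.
move/eqP: e3; rewrite psumr_eq0 => [/allP/(_ i)|k _]; last exact: inner_ge0.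
by rewrite mem_index_iota => /(_ iN)/eqP.
Qed.

(** * Perturbing trajectories through their controls *)

Section Multipliers.
Variables (R : realType) (d nu nobs : nat).
Variable P : planning_data R d nu nobs.
Hypothesis hf : forall w : 'cV[R]_(2 + d) * 'cV[R]_nu, differentiable (dyn P) w.
Hypothesis hQ0 : posdef (Q0 P).
Hypothesis hr : forall j : 'I_nobs, 0 < obs_radius P j.

Notation state := 'cV[R]_(2 + d).
Notation ctrl := 'cV[R]_nu.
Implicit Types (z : nat -> state) (u : nat -> ctrl).

Lemma obs_dist_ge0 j x : 0 <= obs_dist P j x.
Proof. exact: sqrtr_ge0. Qed.

Lemma obs_le0 j x : (obs P j x <= 0) = (obs_radius P j <= obs_dist P j x).
Proof. by rewrite subr_le0 ler_sqr// nnegrE ?obs_dist_ge0// ltW. Qed.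

Lemma obs_lt0 j x : (obs P j x < 0) = (obs_radius P j < obs_dist P j x).
Proof. by rewrite subr_lt0 ltr_sqr// nnegrE ?obs_dist_ge0// ltW. Qed.

(* [w.1] and [w.2] are the state and control perturbations. *)
Definition linearized N z u (w : (nat -> state) * (nat -> ctrl)) : Prop :=
  w.1 1%N = 0 /\ forall i, (1 <= i <= N)%N ->
    w.1 i.+1 = dfdz P (z i) (u i) *m w.1 i + dfdu P (z i) (u i) *m w.2 i.

Lemma linearized0 N z u : linearized N z u 0.
Proof. by split=> // i _; rewrite !mulmx0 addr0. Qed.

Lemma linearizedP N z u a w w' : linearized N z u w -> linearized N z u w' ->
  linearized N z u (a *: w + w').
Proof.
move=> [w0 wS] [w'0 w'S]; split.
  by rewrite -[LHS]/(a *: w.1 1%N + w'.1 1%N) w0 w'0 scaler0 addr0.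
move=> i iN.
rewrite -[LHS]/(a *: w.1 i.+1 + w'.1 i.+1) wS// w'S//.
rewrite -[(_ + _).1 i]/(a *: w.1 i + w'.1 i).
rewrite -[(_ + _).2 i]/(a *: w.2 i + w'.2 i).
by rewrite !mulmxDr -!scalemxAr scalerDr addrACA.
Qed.

Fixpoint rollout (x0 : state) u k : state :=
  if k is k'.+1 then dyn P (rollout x0 u k', u k) else x0.

(* Off by one: [rollout x0 u k] is the state with 1-based index [k.+1]. *)
Lemma rollout_feasible x0 N z u k : feasible P x0 N z u -> (k <= N)%N ->
  rollout x0 u k = z k.+1.
Proof.
move=> [z1 zS _ _ _]; elim: k => [//|k IH kN] /=.
by rewrite IH ?(zS k.+1)//; lia.
Qed.

Section Perturbation.
Variables (x0 : state) (N : nat) (z : nat -> state) (u : nat -> ctrl).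
Variable w : (nat -> state) * (nat -> ctrl).
Hypothesis zu : feasible P x0 N z u.
Hypothesis hw : linearized N z u w.

(** Controls move along a line and states follow by [rollout], so the initial condition and the
    dynamics hold exactly for every [t]; only the inequalities remain to be checked. *)
Definition ctrl_curve (t : R) : nat -> ctrl := fun i => u i + t *: w.2 i.
Definition state_curve (t : R) : nat -> state :=
  fun i => rollout x0 (ctrl_curve t) i.-1.

Lemma ctrl_curve0 i : ctrl_curve 0 i = u i.
Proof. by rewrite /ctrl_curve scale0r addr0. Qed.

Lemma state_curve0 i : (1 <= i <= N.+1)%N -> state_curve 0 i = z i.
Proof.
case: i => // i iN; rewrite -(@rollout_feasible x0 N z u)//.
by congr rollout; apply/funext => k; exact: ctrl_curve0.
Qed.

Lemma is_diff_ctrl_curve i :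
  is_diff (0 : R) (ctrl_curve ^~ i) ( *:%R^~ (w.2 i)).
Proof.
have := is_diffD (is_diff_cst (u i) (0 : R)) (is_diff_scalel 0 (w.2 i)).
by move=> /is_diff_eq; apply; rewrite add0r.
Qed.

(** Induction on time: the chain rule through the dynamics reproduces the recursion of
    [linearized]. *)
Lemma is_diff_state_curve i : (1 <= i <= N.+1)%N ->
  is_diff (0 : R) (state_curve ^~ i) ( *:%R^~ (w.1 i)).
Proof.
case: i => // i; elim: i => [_|i IH iN].
  apply: is_diff_eq (is_diff_cst x0 (0 : R)) _.
  by rewrite hw.1; apply/funext => t; rewrite scaler0.
have iN' : (1 <= i.+1 <= N.+1)%N by lia.
have dp := is_diff_pair (IH iN') (is_diff_ctrl_curve i.+1).
have dd := is_diff_dyn hf (z i.+1) (u i.+1).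
rewrite -(state_curve0 iN') -(ctrl_curve0 i.+1) in dd.
apply: is_diff_eq (is_diff_comp dp dd) _.
apply/funext => t /=.
by rewrite state_curve0// ctrl_curve0 (hw.2 i.+1)// scalerDr !scalemxAr.
Qed.

Lemma is_diff_comp_curve (n : nat) (g : 'cV[R]_n -> R) (c : R -> 'cV[R]_n)
    (x v : 'cV[R]_n) :
  is_diff (0 : R) c ( *:%R^~ v) -> c 0 = x -> differentiable g x ->
  is_diff (0 : R) (fun t => g (c t)) ( *:%R^~ (inner (grad g x) v)).
Proof.
move=> dc c0; rewrite -c0 => dg.
apply: is_diff_eq (is_diff_comp dc (is_diff_grad dg)) _.
by apply/funext => t /=; rewrite innerZr.
Qed.

Lemma curve_near (n : nat) (c : R -> 'cV[R]_n) (x v : 'cV[R]_n)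
    (e : R) :
  0 < e -> is_diff (0 : R) c ( *:%R^~ v) -> c 0 = x ->
  \forall t \near (0 : R)^'+, `|c t - x| < e.
Proof.
move=> e0 dc <-.
have /differentiable_continuous cc : differentiable c (0 : R) by exact: ex_diff.
have cr : c t @[t --> (0 : R)^'+] --> c 0.
  by apply: cvg_at_right_filter; exact: cc.
by move/cvgr_distC_lt : cr; exact.
Qed.

End Perturbation.

Lemma near_right_nat (N : nat) (A : nat -> R -> Prop) :
  (forall i, (1 <= i <= N)%N -> \forall t \near (0 : R)^'+, A i t) ->
  \forall t \near (0 : R)^'+, forall i, (1 <= i <= N)%N -> A i t.
Proof.
move=> H.
have : \forall t \near (0 : R)^'+, forall k : 'I_N, A k.+1 t.
  by apply: filter_forall => k; apply: H; rewrite /= ltn_ord.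
apply: filterS => t At [//|i] iN; exact: (At (Ordinal iN)).
Qed.

(** Otherwise the curve in direction [w] would, for small positive [t], be feasible, close to the
    optimizer and strictly cheaper. *)
Lemma no_descent_direction x0 N z u w :
  local_optimizer P x0 N z u -> linearized N z u w ->
  (forall i j, (2 <= i <= N.+1)%N -> obs P j (z i) = 0 ->
    inner (grad (obs P j) (z i)) (w.1 i) < 0) ->
  (forall i, (2 <= i <= N.+1)%N -> G1 P (z i) = 0 ->
    inner (grad (G1 P) (z i)) (w.1 i) < 0) ->
  (forall i, (1 <= i <= N)%N -> G2 P (u i) = 0 ->
    inner (grad (G2 P) (u i)) (w.2 i) < 0) ->
  0 <= inner (grad (terminal_cost P) (z N.+1)) (w.1 N.+1).
Proof.
move=> [zu [e e0 opt]] hw wobs wG1 wG2; rewrite leNgt; apply/negP => wcost.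
have [z1 zS zG1 zG2 zobs] := zu.
pose zt := state_curve x0 u w; pose ut := ctrl_curve u w.
have zt0 i : (1 <= i <= N.+1)%N -> zt 0 i = z i by exact: state_curve0.
have dz i : (1 <= i <= N.+1)%N -> is_diff (0 : R) (zt ^~ i) ( *:%R^~ (w.1 i)).
  exact: (is_diff_state_curve zu hw).
have du i := is_diff_ctrl_curve u w i.
have zt1 t : zt t 1%N = z 1%N by rewrite z1.
have Hcost : \forall t \near (0 : R)^'+,
    terminal_cost P (zt t N.+1) - terminal_cost P (z N.+1) < 0.
  have N1 : (1 <= N.+1 <= N.+1)%N by lia.
  have dc := is_diff_comp_curve (dz _ N1) (zt0 _ N1)
    (differentiable_terminal_cost hQ0 (z N.+1)).
  have := is_diffB dc (is_diff_cst (terminal_cost P (z N.+1)) (0 : R)).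
  rewrite subr0 => /right_near_lt0; apply; right.
  by split => //; rewrite -[LHS]/(_ - _) zt0// subrr.
have HG1 : \forall t \near (0 : R)^'+, forall i, (1 <= i <= N.+1)%N ->
    G1 P (zt t i) <= 0.
  apply: near_right_nat => i iN.
  (* The curve keeps the pinned state fixed, so its constraints are inherited from the optimizer;
     descent is only assumed from index 2 on. *)
  have [->|i1] := eqVneq i 1%N.
    by apply: nearW => t; rewrite zt1; exact: zG1.
  have dc := is_diff_comp_curve (dz _ iN) (zt0 _ iN)
    (differentiable_G1 P (z i)).
  apply: filterS (right_near_lt0 dc _); first by move=> t; exact: ltW.
  rewrite zt0//; have := zG1 i iN.
  rewrite le_eqVlt => /orP[/eqP G|]; last by left.
  by right; split => //; apply: wG1 => //; lia.
have Hobs : \forall t \near (0 : R)^'+, forall i, (1 <= i <= N.+1)%N ->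
    forall j, obs P j (zt t i) <= 0.
  apply: near_right_nat => i iN; apply: filter_forall => j.
  have zij : obs P j (z i) <= 0 by rewrite obs_le0; exact: zobs.
  have [->|i1] := eqVneq i 1%N.
    by apply: nearW => t; rewrite zt1 obs_le0; exact: zobs.
  have dc := is_diff_comp_curve (dz _ iN) (zt0 _ iN)
    (differentiable_obs P j (z i)).
  apply: filterS (right_near_lt0 dc _); first by move=> t; exact: ltW.
  rewrite zt0//; move: zij; rewrite le_eqVlt => /orP[/eqP G|]; last by left.
  by right; split => //; apply: wobs => //; lia.
have HG2 : \forall t \near (0 : R)^'+, forall i, (1 <= i <= N)%N ->
    G2 P (ut t i) <= 0.
  apply: near_right_nat => i iN.
  have dc := is_diff_comp_curve (du i) (ctrl_curve0 u w i)
    (differentiable_G2 P (u i)).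
  apply: filterS (right_near_lt0 dc _); first by move=> t; exact: ltW.
  rewrite ctrl_curve0.
  have := zG2 i iN; rewrite le_eqVlt => /orP[/eqP G|]; last by left.
  by right; split => //; apply: wG2 => //; lia.
have Hz : \forall t \near (0 : R)^'+, forall i, (1 <= i <= N.+1)%N ->
    `|zt t i - z i| < e.
  by apply: near_right_nat => i iN; exact: curve_near e0 (dz i iN) (zt0 i iN).
have Hu : \forall t \near (0 : R)^'+, forall i, (1 <= i <= N)%N ->
    `|ut t i - u i| < e.
  apply: near_right_nat => i iN.
  exact: curve_near e0 (du i) (ctrl_curve0 u w i).
near (0 : R)^'+ => t.
have tcost : terminal_cost P (zt t N.+1) - terminal_cost P (z N.+1) < 0.
  by near: t.
have tG1 : forall i, (1 <= i <= N.+1)%N -> G1 P (zt t i) <= 0 by near: t.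
have tobs : forall i, (1 <= i <= N.+1)%N -> forall j, obs P j (zt t i) <= 0.
  by near: t.
have tG2 : forall i, (1 <= i <= N)%N -> G2 P (ut t i) <= 0 by near: t.
have tz : forall i, (1 <= i <= N.+1)%N -> `|zt t i - z i| < e by near: t.
have tu : forall i, (1 <= i <= N)%N -> `|ut t i - u i| < e by near: t.
have fzt : feasible P x0 N (zt t) (ut t).
  split=> //; first by case.
  by move=> i j iN; rewrite -obs_le0; exact: tobs.
have := opt _ _ fzt tz tu.
by rewrite leNgt -subr_lt0 => /negP; apply.
Unshelve. all: by end_near.
Qed.

End Multipliers.

(** * Existence of KKT multipliers under the constraint qualification *)

Lemma sum_inner_eq_nat (R : realType) (n : nat) (F v : nat -> 'cV[R]_n)
    (a b l : nat) :
  \sum_(a <= i < b) inner ((i == l)%:R *: F i) (v i) =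
  (a <= l < b)%:R * inner (F l) (v l).
Proof.
rewrite -[RHS](sum_eq_nat (fun i => inner (F i) (v i) : R^o)).
by apply: eq_bigr => i _; rewrite innerZl eq_sym.
Qed.

Section Existence.
Variables (R : realType) (d nu nobs : nat).
Variable P : planning_data R d nu nobs.
Hypothesis hf : forall w : 'cV[R]_(2 + d) * 'cV[R]_nu, differentiable (dyn P) w.
Hypothesis hQ0 : posdef (Q0 P).
Hypothesis hr : forall j : 'I_nobs, 0 < obs_radius P j.

Notation state := 'cV[R]_(2 + d).
Notation ctrl := 'cV[R]_nu.
Implicit Types (z dz : nat -> state) (u du : nat -> ctrl).

Lemma slope_state (g : state -> R) N z u dz du i : (2 <= i <= N.+1)%N ->
  differentiable g (z i) ->
  slope N (fun z' _ => g (z' i)) z u dz du = inner (grad g (z i)) (dz i).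
Proof.
move=> iN dg; rewrite /slope.
have ez l : gradz (fun z' _ => g (z' i)) z u l = (l == i)%:R *: grad g (z i).
  by apply: grad_is_diff; exact: is_grad_upd.
have eu l : gradu (fun z' _ => g (z' i)) z u l = 0.
  by apply: grad_is_diff; exact: is_grad_cst.
under eq_bigr do rewrite ez.
under [X in _ + X]eq_bigr do rewrite eu inner0l.
rewrite big1_eq addr0 (sum_inner_eq_nat (fun=> grad g (z i))).
by rewrite (_ : (1 < i < _)%N) ?mul1r//; lia.
Qed.

Lemma slope_ctrl (g : ctrl -> R) N z u dz du i : (1 <= i <= N)%N ->
  differentiable g (u i) ->
  slope N (fun _ u' => g (u' i)) z u dz du = inner (grad g (u i)) (du i).
Proof.
move=> iN dg; rewrite /slope.
have eu l : gradu (fun _ u' => g (u' i)) z u l = (l == i)%:R *: grad g (u i).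
  by apply: grad_is_diff; exact: is_grad_upd.
have ez l : gradz (fun _ u' => g (u' i)) z u l = 0.
  by apply: grad_is_diff; exact: is_grad_cst.
under eq_bigr do rewrite ez inner0l.
under [X in _ + X]eq_bigr do rewrite eu.
rewrite big1_eq add0r (sum_inner_eq_nat (fun=> grad g (u i))).
by rewrite (_ : (0 < i < _)%N) ?mul1r//; lia.
Qed.

(** [slope] ranges over the decision variables only, so no [dz 1] term occurs; the factor [(2 <= i)]
    records this. *)
Lemma slope_dyn N z u dz du i k : (1 <= i <= N)%N ->
  slope N (dyn_constraint P i k) z u dz du =
  (dz i.+1 - (dfdz P (z i) (u i) *m ((2 <= i)%N%:R *: dz i)
              + dfdu P (z i) (u i) *m du i)) k 0.
Proof.
move=> iN; rewrite -[RHS]inner_deltar innerC.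
set e := delta_mx k 0.
have cE : dyn_constraint P i k = fun z' u' => inner e (gap P z' u' i).
  by apply/funext => z'; apply/funext => u'; rewrite innerC inner_deltar.
rewrite cE /slope.
under eq_bigr => l _ do
  rewrite /gradz (grad_is_diff (is_grad_gapz hf e z u i l)) innerDl innerNl.
under [X in _ + X]eq_bigr => l _ do
  rewrite /gradu (grad_is_diff (is_grad_gapu hf e z u i l)) innerNl.
rewrite sumrB sumrN (sum_inner_eq_nat (fun=> e)).
rewrite (sum_inner_eq_nat (fun=> (dfdz P (z i) (u i))^T *m e)).
rewrite (sum_inner_eq_nat (fun=> (dfdu P (z i) (u i))^T *m e)).
rewrite innerDr innerNr innerDr -!inner_mulmx.
have e1 : (1 < i.+1 < N.+2)%N by lia.
have e2 : (1 < i < N.+2)%N = (1 < i)%N by lia.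
by rewrite e1 e2 -scalemxAr innerZr !mul1r; ring.
Qed.

(** A direction of the constraint qualification leaves [dz 1] arbitrary; resetting it to 0 expresses
    that the initial state is pinned. *)
Lemma linearized_of_slope N z u dz du :
  (forall i k, (1 <= i <= N)%N ->
    slope N (dyn_constraint P i k) z u dz du = 0) ->
  linearized P N z u (upd dz 1 0, du).
Proof.
move=> H; split=> // i iN.
apply/eqP; rewrite -subr_eq0; apply/eqP/colP => k; rewrite [RHS]mxE.
rewrite -(H i k iN) slope_dyn//=.
have -> : upd dz 1 0 i.+1 = dz i.+1 by rewrite /upd; case: i iN.
have -> // : upd dz 1 0 i = (1 < i)%N%:R *: dz i.
by rewrite /upd; case: i iN => // -[|i] _; rewrite ?scale0r ?scale1r.
Qed.

Lemma multiplier_rule x0 N z u :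
  local_optimizer P x0 N z u -> MFCQ P N z u ->
  exists mo : nat -> 'I_nobs -> R, exists ms mc : nat -> R,
  [/\ forall i j, 0 <= mo i j /\ mo i j * obs P j (z i) = 0,
      forall i, 0 <= ms i /\ ms i * G1 P (z i) = 0,
      forall i, 0 <= mc i /\ mc i * G2 P (u i) = 0,
      ((forall j, mo 1%N j = 0) /\ ms 1%N = 0) &
      forall w, linearized P N z u w ->
        inner (grad (terminal_cost P) (z N.+1)) (w.1 N.+1)
        + \sum_(2 <= i < N.+2)
            (\sum_(j < nobs) mo i j * inner (grad (obs P j) (z i)) (w.1 i)
             + ms i * inner (grad (G1 P) (z i)) (w.1 i))
        + \sum_(1 <= i < N.+1) mc i * inner (grad (G2 P) (u i)) (w.2 i) = 0].
Proof.
move=> opt [_ [dz [du [ddyn dobs dG1 dG2]]]].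
(* Index set of the functionals for Gordan's alternative: [None] is the cost, and the summands stand
   for obstacle, state and control constraints. *)
pose I : eqType := option ((nat * 'I_nobs) + (nat + nat))%type.
pose l (c : I) (w : (nat -> state) * (nat -> ctrl)) : R := match c with
  | None => inner (grad (terminal_cost P) (z N.+1)) (w.1 N.+1)
  | Some (inl (i, j)) => inner (grad (obs P j) (z i)) (w.1 i)
  | Some (inr (inl i)) => inner (grad (G1 P) (z i)) (w.1 i)
  | Some (inr (inr i)) => inner (grad (G2 P) (u i)) (w.2 i)
  end.
pose active (c : I) : bool := match c with
  | None => true
  | Some (inl (i, j)) => obs P j (z i) == 0
  | Some (inr (inl i)) => G1 P (z i) == 0
  | Some (inr (inr i)) => G2 P (u i) == 0
  end.
pose s : seq I := None :: [seq Some (inl (i, j)) | i <- index_iota 2 N.+2,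
    j <- index_enum 'I_nobs]
  ++ [seq Some (inr (inl i)) | i <- index_iota 2 N.+2]
  ++ [seq Some (inr (inr i)) | i <- index_iota 1 N.+1].
have us : uniq s.
  have u3 : uniq [seq Some (inl (i, j)) : I | i <- index_iota 2 N.+2,
      j <- index_enum 'I_nobs].
    apply: allpairs_uniq; [exact: iota_uniq|exact: index_enum_uniq|].
    by move=> [? ?] [? ?] _ _ /= [-> ->].
  rewrite /s cons_uniq !cat_uniq u3 !map_inj_uniq ?iota_uniq; last 2 first.
  - by move=> ? ? [].
  - by move=> ? ? [].
  rewrite !mem_cat !andbT andTb; apply/and3P; split.
  - rewrite !negb_or; apply/and3P; split.
        by apply/allpairsP => -[[? ?] []].
      by apply/mapP => -[].
    by apply/mapP => -[].
  - apply/hasPn => c; rewrite mem_cat => /orP[] /mapP[i _ ->];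
      by apply/allpairsP => -[[? ?] []].
  - by apply/hasPn => c /mapP[i _ ->]; apply/mapP => -[].
have inN k : (2 <= k <= N.+1)%N = (k \in index_iota 2 N.+2).
  by rewrite mem_index_iota.
have s_obs i j : (Some (inl (i, j)) : I) \in s -> (2 <= i <= N.+1)%N.
  rewrite inE /= !mem_cat.
  move=> /or3P[/allpairsP[[? ?] [im _ [-> _]]]|/mapP[]|/mapP[]]//.
  by move: im; rewrite mem_index_iota.
have s_G1 i : (Some (inr (inl i)) : I) \in s -> (2 <= i <= N.+1)%N.
  rewrite inE /= !mem_cat.
  move=> /or3P[/allpairsP[[? ?] []]|/mapP[? im [->]]|/mapP[]]//.
  by move: im; rewrite mem_index_iota.
have s_G2 i : (Some (inr (inr i)) : I) \in s -> (1 <= i <= N)%N.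
  rewrite inE /= !mem_cat.
  move=> /or3P[/allpairsP[[? ?] []]|/mapP[]|/mapP[? im [->]]]//.
  by move: im; rewrite mem_index_iota.
have obs_s i j : (2 <= i <= N.+1)%N -> (Some (inl (i, j)) : I) \in s.
  move=> iN; rewrite inE /= !mem_cat; apply/or3P/Or31/allpairsP.
  by exists (i, j); rewrite mem_index_iota mem_index_enum.
have G1_s i : (2 <= i <= N.+1)%N -> (Some (inr (inl i)) : I) \in s.
  move=> iN; rewrite inE /= !mem_cat; apply/or3P/Or32/mapP.
  by exists i; rewrite ?mem_index_iota.
have G2_s i : (1 <= i <= N)%N -> (Some (inr (inr i)) : I) \in s.
  move=> iN; rewrite inE /= !mem_cat; apply/or3P/Or33/mapP.
  by exists i; rewrite ?mem_index_iota.
pose wM : (nat -> state) * (nat -> ctrl) := (upd dz 1 0, du).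
have wMlin : linearized P N z u wM by exact: linearized_of_slope.
have wM1 i : (2 <= i)%N -> wM.1 i = dz i.
  by move=> i2; rewrite /= /upd; case: i i2 => [|[]].
have wMneg c : c \in s -> active c -> c != None -> l c wM < 0.
  case: c => [[[i j]|[i|i]]|]//.
  - move=> /s_obs iN /eqP a _; rewrite /l wM1; last by lia.
    rewrite -(@slope_state _ N z u dz du)//; last exact: differentiable_obs.
    exact: dobs.
  - move=> /s_G1 iN /eqP a _; rewrite /l wM1; last by lia.
    rewrite -(@slope_state _ N z u dz du)//; last exact: differentiable_G1.
    exact: dG1.
  - move=> /s_G2 iN /eqP a _; rewrite /l.
    rewrite -(@slope_ctrl _ N z u dz du)//; last exact: differentiable_G2.
    exact: dG2.
have lP c a w w' : l c (a *: w + w') = a * l c w + l c w'.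
  case: c => [[[i j]|[i|i]]|] /=.
  - by rewrite -innerZr -innerDr.
  - by rewrite -innerZr -innerDr.
  - by rewrite -innerZr -innerDr.
  - by rewrite -innerZr -innerDr.
(* Gordan's alternative for the cost and the active constraints on the space of linearized
   trajectories; a strict solution would be a forbidden descent direction. *)
case: (gordan_alternative (filter_uniq active us) (linearized0 P N z u)
    (@linearizedP _ _ _ _ P N z u) lP)
  => [[w hw wneg]|[lam [lam0 [c0 sc0 lc0] lamE]]].
  have := no_descent_direction hf hQ0 hr opt hw.
  have wn c : c \in s -> active c -> l c w < 0.
    by move=> sc ac; apply: wneg; rewrite mem_filter ac.
  have := wn None (mem_head _ _) isT; rewrite /= ltNge => /negP + H.
  case; apply: H.
  - by move=> i j iN /eqP; exact: (wn (Some (inl (i, j))) (obs_s _ _ iN)).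
  - by move=> i iN /eqP; exact: (wn (Some (inr (inl i))) (G1_s _ iN)).
  - by move=> i iN /eqP; exact: (wn (Some (inr (inr i))) (G2_s _ iN)).
(* With zero weight on the cost, the direction [wM] would make the vanishing combination strictly
   negative, as the positive weight at [c0] would then fall on an active constraint. *)
have lamN : 0 < lam None.
  rewrite lt_neqAle lam0 andbT eq_sym; apply/eqP => l0.
  have := lamE _ wMlin.
  rewrite (perm_big _ (perm_to_rem sc0)) big_cons => /eqP; rewrite lt_eqF//.
  have neg c : c \in [seq x <- s | active x] -> lam c * l c wM <= 0.
    rewrite mem_filter => /andP[ac sc]; case: (eqVneq c None) => [->|cN].
      by rewrite l0 mul0r.
    by rewrite mulr_ge0_le0// ltW// wMneg.
  rewrite ltr_wnDr//.
    rewrite big_seq; apply: sumr_le0 => c cs; apply: neg; exact: mem_rem cs.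
  move: sc0; rewrite mem_filter => /andP[ac sc].
  rewrite pmulr_rlt0// wMneg//.
  by apply/eqP => cN; move: lc0; rewrite cN l0 ltxx.
(* Normalised to weight 1 on the cost. The value 0 on inactive constraints gives complementarity. *)
pose m (c : I) : R := if active c then lam c / lam None else 0.
have m0 c : 0 <= m c by rewrite /m; case: ifP => // _; rewrite divr_ge0.
(* [s] lists state constraints from index 2 on; at the pinned state the multipliers are set to 0. *)
exists (fun i j => if i == 1%N then 0 else m (Some (inl (i, j)))).
exists (fun i => if i == 1%N then 0 else m (Some (inr (inl i)))).
exists (fun i => m (Some (inr (inr i)))).
split => //.
- move=> i j; case: ifP => _; split => //; rewrite ?mul0r//.
  by rewrite /m /=; case: eqP => [->|]; rewrite ?mulr0 ?mul0r.
- move=> i; case: ifP => _; split => //; rewrite ?mul0r//.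
  by rewrite /m /=; case: eqP => [->|]; rewrite ?mulr0 ?mul0r.
- move=> i; split => //.
  by rewrite /m /=; case: eqP => [->|]; rewrite ?mulr0 ?mul0r.
move=> w /lamE; rewrite big_filter big_mkcond => lE.
have : \sum_(c <- s) m c * l c w = 0.
  apply: (mulfI (lt0r_neq0 lamN)); rewrite mulr0 -[RHS]lE mulr_sumr.
  apply: eq_bigr => c _; rewrite /m; case: ifP => _; rewrite ?mul0r ?mulr0//.
  by rewrite mulrA [lam None * _]mulrC divfK ?gt_eqF.
rewrite /s big_cons !big_cat big_allpairs_dep !big_map /= => {}lE.
have mN : m None = 1 by rewrite /m divff// gt_eqF.
rewrite -[RHS]lE mN mul1r big_split -!addrA.
congr (_ + (_ + (_ + _))).
- rewrite !big_seq; apply: eq_bigr => i; rewrite -inN// => i2.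
  by apply: eq_bigr => j _; rewrite ifF//; lia.
- rewrite !big_seq; apply: eq_bigr => i; rewrite -inN// => i2.
  by rewrite ifF//; lia.
Qed.

(** The inequality multipliers come from [multiplier_rule]. Its identity is the hypothesis of
    [adjoint_sequence], whose three conclusions are the stationarity conditions at the last state,
    the other states and the controls. *)
Lemma KKT_exists x0 N z u :
  local_optimizer P x0 N z u -> MFCQ P N z u -> exists mu, KKT P x0 N z u mu.
Proof.
move=> opt cq.
have [mo [ms [mc [moP msP mcP [mo1 ms1] E]]]] := multiplier_rule opt cq.
(* A placeholder: [state_force] reads only the inequality multipliers, so the zero costates do not
   affect it. *)
pose mu' : multipliers R d nobs := Multipliers (fun=> 0) mo ms mc.
pose h i := (i == N.+1)%:R *: grad (terminal_cost P) (z i)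
  + state_force P mu' z i.
have [|ups [upsN upsS upsu]] := @adjoint_sequence R _ _ N
    (fun i => dfdz P (z i) (u i)) (fun i => dfdu P (z i) (u i)) h
    (fun i => mc i *: grad (G2 P) (u i)).
  move=> x v x1 xS; have := E (x, v) (conj x1 xS) => /= {}E.
  (* For [N = 0] the cost sits on the pinned state, outside both sums. *)
  have [N0|N0] := posnP N.
    by rewrite N0 !big_geq ?addr0.
  rewrite -[RHS]E.
  under eq_bigr do rewrite innerDl.
  rewrite big_split (sum_inner_eq_nat (fun i => grad (terminal_cost P) (z i))).
  rewrite (_ : (1 < N.+1 < _)%N) ?mul1r; last by lia.
  congr (_ + _ + _).
    apply: eq_bigr => i _; rewrite /state_force innerDl inner_suml innerZl.
    by congr (_ + _); apply: eq_bigr => j _; rewrite innerZl.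
  by apply: eq_bigr => i _; rewrite innerZl.
pose mu := Multipliers ups mo ms mc.
exists mu; split.
- by case: opt.
- split=> i iN.
    rewrite gradz_lagrangian//.
    rewrite -[state_force P mu z i]/(state_force P mu' z i).
    rewrite addrAC -/(h i) /=.
    have [->|iN1] := eqVneq i N.+1.
      by rewrite ltnn scale0r subr0 upsN addrN.
    have -> : (i <= N)%N by lia.
    rewrite scale1r upsS; last by lia.
    by rewrite [X in _ + X]addrAC subrr add0r addrN.
  by rewrite gradu_lagrangian//= upsu// subrr.
- by move=> i _; split=> [j|]; [case: (moP i j)|case: (msP i)].
- by move=> i _; case: (mcP i).
- split=> i _; last by case: (mcP i).
  by split=> [j|]; [case: (moP i j)|case: (msP i)].
Qed.

End Existence.

(** Makes the matrix product a monoid law, so that the last factor of the products in [reach] can be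
    split off. *)
HB.instance Definition _ (R : pzSemiRingType) (n : nat) :=
  Monoid.isLaw.Build 'M[R]_n 1%:M (@mulmx R n n n) (@mulmxA R n n n n)
    (@mul1mx R n n) (@mulmx1 R n n).

(** * Vanishing costates and concatenation of KKT points *)

Section Stitching.
Variables (R : realType) (d nu nobs : nat).
Variable P : planning_data R d nu nobs.
Hypothesis hf : forall w : 'cV[R]_(2 + d) * 'cV[R]_nu, differentiable (dyn P) w.
Hypothesis hQ0 : posdef (Q0 P).
Hypothesis hr : forall j : 'I_nobs, 0 < obs_radius P j.

Notation state := 'cV[R]_(2 + d).
Notation ctrl := 'cV[R]_nu.
Implicit Types (z : nat -> state) (u : nat -> ctrl).

(* The hypotheses say that [lam I] annihilates every block of the reachability
   matrix, where [I = p + tau - 1]. *)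
Lemma costate_eq0 (lam : nat -> state) z u p tau :
  (1 <= tau)%N ->
  (forall i, (p <= i <= p + tau - 1)%N ->
    (dfdu P (z i) (u i))^T *m lam i = 0) ->
  (forall i, (p < i <= p + tau - 1)%N ->
    lam i.-1 = (dfdz P (z i) (u i))^T *m lam i) ->
  \rank (reach P tau z u (p + tau - 1)) = (2 + d)%N ->
  lam p = 0.
Proof.
move=> tau1 lamB lamA; set I := (p + tau - 1)%N => rk.
(* The factor in front of the control Jacobian in block [k] of [reach]; its transpose carries the
   costate of index [I] back to index [I - k]. *)
pose Phi k := \big[mulmx/1%:M]_(0 <= l < k) dfdz P (z (I - l)%N) (u (I - l)%N).
have lamE k : (k < tau)%N -> lam (I - k)%N = (Phi k)^T *m lam I.
  elim: k => [_|k IH ktau]; first by rewrite /Phi big_nil trmx1 mul1mx subn0.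
  rewrite /Phi big_nat_recr// -/(Phi k) trmx_mul -mulmxA -IH; last by lia.
  by rewrite -lamA ?subnS//; lia.
have lamI : (lam I)^T *m reach P tau z u I = 0.
  rewrite /reach mul_mxrow -[RHS]mxrow0; apply: eq_mxrow => k.
  rewrite -/(Phi k) mulmxA.
  (* Block [k] of the product is, transposed, the control condition at index [I - k]. *)
  apply: trmx_inj; rewrite !trmx_mul trmxK trmx0 -lamE; last exact: ltn_ord.
  by apply: lamB; have := ltn_ord k; lia.
have rf : row_free (reach P tau z u I) by rewrite /row_free rk.
have lamI0 : lam I = 0.
  apply: trmx_inj; rewrite trmx0; apply: (row_free_inj rf).
  by rewrite lamI mul0mx.
rewrite (_ : p = I - (tau - 1))%N; last by lia.
by rewrite lamE ?lamI0 ?mulmx0//; lia.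
Qed.

(** Complementarity kills the multipliers of the strictly satisfied constraints. *)
Lemma state_force_eq0 x0 N z u mu i : KKT P x0 N z u mu ->
  (1 <= i <= N.+1)%N ->
  (forall j, obs_radius P j < obs_dist P j (z i)) -> G1 P (z i) < 0 ->
  state_force P mu z i = 0.
Proof.
move=> [_ _ cs _ _] iN ob G; have [cso csG] := cs i iN.
rewrite /state_force big1 => [|j _]; rewrite ?add0r.
  move/eqP: csG; rewrite mulf_eq0 (lt_eqF G) orbF => /eqP ->.
  by rewrite scale0r.
move/eqP: (cso j); rewrite mulf_eq0 (lt_eqF (_ : obs P j (z i) < 0)) ?orbF.
  by move=> /eqP ->; rewrite scale0r.
by rewrite obs_lt0.
Qed.

(** Stationarity at [z i] links the costates [i.-1] and [i], so the state conditions start at [p.+1]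
    while the control conditions start at [p]. The bound by [N] keeps the terminal cost out of this
    window. *)
Lemma KKT_costate_eq0 x0 N z u mu p tau :
  KKT P x0 N z u mu -> (1 <= tau)%N -> (1 <= p)%N -> (p + tau - 1 <= N)%N ->
  (forall i, (p <= i <= p + tau - 1)%N -> quad (Q2 P) (u i) < 1) ->
  (forall i, (p.+1 <= i <= p + tau - 1)%N ->
    (forall j, obs_radius P j < obs_dist P j (z i)) /\ G1 P (z i) < 0) ->
  \rank (reach P tau z u (p + tau - 1)) = (2 + d)%N ->
  mu_dyn mu p = 0.
Proof.
move=> K tau1 p1 pN uin zin; apply: costate_eq0 => // i ip.
- have iN : (1 <= i <= N)%N by lia.
  have [_ [_ /(_ i iN) gu] _ /(_ i iN)/eqP cc _] := K.
  move: cc gu; rewrite gradu_lagrangian// mulf_eq0.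
  rewrite (lt_eqF (_ : G2 P (u i) < 0)); last by rewrite subr_lt0; exact: uin.
  rewrite orbF => /eqP ->.
  by rewrite scale0r sub0r => /eqP; rewrite oppr_eq0 => /eqP.
- have iN : (2 <= i <= N.+1)%N by lia.
  have [_ [/(_ i iN) + _] _ _ _] := K.
  have [ob G] := zin i ip.
  rewrite gradz_lagrangian// (state_force_eq0 K)//; last by lia.
  have -> : (i == N.+1) = false by lia.
  have -> : (i <= N)%N by lia.
  by rewrite scale0r add0r addr0 scale1r => /eqP; rewrite subr_eq0 => /eqP.
Qed.

(** Each condition involves neighbouring indices only, so all are inherited from one cycle except
    stationarity at the stitching state, where costates of both cycles meet. *)
Lemma KKT_concat x0 m n m' z1 z2 u1 u2 mu1 mu2 :
  (1 <= m')%N -> (m' < m)%N -> (1 <= n)%N ->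
  KKT P x0 m z1 u1 mu1 -> KKT P (z1 m'.+1) n z2 u2 mu2 ->
  mu_dyn mu1 m' = 0 -> mu_dyn mu2 1 = 0 -> state_force P mu2 z2 1 = 0 ->
  KKT P x0 (m' + n) (concat_states m' z1 z2) (concat_seq m' u1 u2)
    (concat_multipliers m' mu1 mu2).
Proof.
move=> m'1 m'm n1 K1 K2 mu10 mu20 f0.
set zc := concat_states _ _ _; set uc := concat_seq _ _ _.
set muc := concat_multipliers _ _ _.
have z21 : z2 1%N = z1 m'.+1 by case: K2 => -[].
have zcl i : (i <= m'.+1)%N -> zc i = z1 i.
  by rewrite /zc /concat_states /splice => ->.
(* At [k = 1] the entry is taken from the first trajectory; the initial condition of the second
   cycle makes the two agree. *)
have zcr k : (1 <= k)%N -> zc (m' + k)%N = z2 k.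
  move=> k1; rewrite /zc /concat_states /splice; case: ifP => h; last first.
    by rewrite addKn.
  by rewrite (_ : k = 1%N) ?addn1//; lia.
have seql (T : Type) (a b : nat -> T) i :
    (i <= m')%N -> concat_seq m' a b i = a i.
  by rewrite /concat_seq /splice => ->.
have seqr (T : Type) (a b : nat -> T) k :
    (1 <= k)%N -> concat_seq m' a b (m' + k)%N = b k.
  by move=> k1; rewrite /concat_seq /splice ifF ?addKn//; lia.
have ucl i : (i <= m')%N -> uc i = u1 i by exact: seql.
have ucr k : (1 <= k)%N -> uc (m' + k)%N = u2 k by exact: seqr.
have fl i : (i <= m')%N -> state_force P muc zc i = state_force P mu1 z1 i.
  by move=> im; rewrite /state_force /muc /= !seql ?zcl//; lia.
have fr k : (1 <= k)%N ->
    state_force P muc zc (m' + k) = state_force P mu2 z2 k.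
  by move=> k1; rewrite /state_force /muc /= !seqr ?zcr.
have split_le i (Q : nat -> Prop) : (forall i, (i <= m')%N -> Q i) ->
    (forall k, (1 <= k)%N -> Q (m' + k)%N) -> Q i.
  move=> Ql Qr; have [|im] := leqP i m'; first exact: Ql.
  by rewrite (_ : i = m' + (i - m'))%N; [apply: Qr|]; lia.
have [[zu11 zu12 zu13 zu14 zu15] [gz1 gu1] cs1 cc1 [ps1 pc1]] := K1.
have [[zu21 zu22 zu23 zu24 zu25] [gz2 gu2] cs2 cc2 [ps2 pc2]] := K2.
split.
- split.
  + by rewrite zcl.
  + elim/split_le => [i im|k k1] iN.
      by rewrite !zcl ?ucl ?zu12//; lia.
    by rewrite -addnS !zcr ?ucr ?zu22//; lia.
  + elim/split_le => [i im|k k1] iN; first by rewrite zcl ?zu13//; lia.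
    by rewrite zcr ?zu23//; lia.
  + elim/split_le => [i im|k k1] iN; first by rewrite ucl ?zu14//; lia.
    by rewrite ucr ?zu24//; lia.
  + move=> i j; move: i; elim/split_le => [i im|k k1] iN.
      by rewrite zcl ?zu15//; lia.
    by rewrite zcr ?zu25//; lia.
- split; elim/split_le => [i im|k k1] iN.
  + have iN1 : (2 <= i <= m.+1)%N by lia.
    rewrite gradz_lagrangian// fl// /muc /= ?seql ?ucl ?zcl; try lia.
    have := gz1 i iN1; rewrite gradz_lagrangian//.
    have -> : (i == m.+1) = false by lia.
    have -> : (i == (m' + n).+1) = false by lia.
    have -> : (i <= m)%N by lia.
    by have -> : (i <= m' + n)%N by lia.
  + rewrite gradz_lagrangian// fr// /muc /= zcr// ?seqr ?ucr//.
    (* The stitching state: both costates and the force vanish, and the terminal cost is absent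
       because [n >= 1]. *)
    have [->|k2] := eqVneq k 1%N.
      rewrite f0 mu20 addn1 /= seql// mu10 mulmx0 scaler0 subr0 !addr0.
      have -> : (m'.+1 == (m' + n).+1) = false by lia.
      by rewrite scale0r.
    have kN1 : (2 <= k <= n.+1)%N by lia.
    have -> : (m' + k).-1 = (m' + k.-1)%N by lia.
    rewrite seqr; last by lia.
    have := gz2 k kN1; rewrite gradz_lagrangian//.
    by rewrite leq_add2l -addnS eqn_add2l.
  + have iN1 : (1 <= i <= m)%N by lia.
    rewrite gradu_lagrangian// /muc /= ?seql ?ucl ?zcl; try lia.
    by have := gu1 i iN1; rewrite gradu_lagrangian.
  + have kN1 : (1 <= k <= n)%N by lia.
    rewrite gradu_lagrangian// /muc /= ?seqr ?ucr ?zcr//.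
    by have := gu2 k kN1; rewrite gradu_lagrangian.
- elim/split_le => [i im|k k1] iN.
    by rewrite /muc /= ?seql ?ucl ?zcl; try lia; apply: cs1; lia.
  by rewrite /muc /= ?seqr ?ucr ?zcr; try lia; apply: cs2; lia.
- elim/split_le => [i im|k k1] iN.
    by rewrite /muc /= ?seql ?ucl; try lia; apply: cc1; lia.
  by rewrite /muc /= ?seqr ?ucr; try lia; apply: cc2; lia.
- split; elim/split_le => [i im|k k1] iN.
  + by rewrite /muc /= !seql//; apply: ps1; lia.
  + by rewrite /muc /= !seqr//; apply: ps2; lia.
  + by rewrite /muc /= !seql//; apply: pc1; lia.
  + by rewrite /muc /= !seqr//; apply: pc2; lia.
Qed.

End Stitching.

(** * Stitching the two planning cycles *)

Theorem theorem2 (R : realType) (d nu nobs : nat)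
  (P : planning_data R d nu nobs)
  (hf : forall w : 'cV[R]_(2 + d) * 'cV[R]_nu, differentiable (dyn P) w)
  (hQ0 : posdef (Q0 P)) (hQ1 : posdef (Q1 P)) (hQ2 : posdef (Q2 P))
  (hr : forall j : 'I_nobs, 0 < obs_radius P j)
  (z0 : 'cV[R]_(2 + d)) (u0 : 'cV[R]_nu)
  (tau m n m' : nat)
  (htau : (1 <= tau)%N)
  (hm'1 : (1 <= m')%N) (hm'm : (m' <= m - 1)%N)
  (hm'tau : (m' + tau - 1 <= m)%N) (htaun : (tau <= n)%N)
  (z1 z2 : nat -> 'cV[R]_(2 + d)) (u1 u2 : nat -> 'cV[R]_nu)
  (hopt1 : local_optimizer P z0 m z1 u1)
  (hopt2 : local_optimizer P (z1 m'.+1) n z2 u2)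
  (* (a) rank assumptions *)
  (hB1 : \rank (dfdu P z0 u0) = nu)
  (hB2 : \rank (dfdu P (z1 m'.+1) (u1 m')) = nu)
  (hC1 : forall i : nat, (tau <= i <= m)%N ->
     \rank (reach P tau z1 u1 i) = (2 + d)%N)
  (hC2 : forall i : nat, (tau <= i <= n)%N ->
     \rank (reach P tau z2 u2 i) = (2 + d)%N)
  (* (b) constraint qualification for all the problems of the family *)
  (hMFCQ : forall (x0 : 'cV[R]_(2 + d)) (N : nat)
     (z : nat -> 'cV[R]_(2 + d)) (u : nat -> 'cV[R]_nu),
     local_optimizer P x0 N z u -> MFCQ P N z u)
  (* (c) inactive control bounds *)
  (hu1 : forall i : nat, (m' <= i <= m' + tau - 1)%N -> quad (Q2 P) (u1 i) < 1)
  (hu2 : forall i : nat, (1 <= i <= tau)%N -> quad (Q2 P) (u2 i) < 1)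
  (* (d) strict feasibility of the states *)
  (hz1 : forall i : nat, (m'.+1 <= i <= m' + tau - 1)%N ->
     (forall j : 'I_nobs, obs_radius P j < obs_dist P j (z1 i)) /\ G1 P (z1 i) < 0)
  (hz2 : forall i : nat, (1 <= i <= tau)%N ->
     (forall j : 'I_nobs, obs_radius P j < obs_dist P j (z2 i)) /\ G1 P (z2 i) < 0) :
  [/\ exists mu1 : multipliers R d nobs, KKT P z0 m z1 u1 mu1,
      exists mu2 : multipliers R d nobs, KKT P (z1 m'.+1) n z2 u2 mu2 &
      forall mu1 mu2 : multipliers R d nobs,
        KKT P z0 m z1 u1 mu1 ->
        KKT P (z1 m'.+1) n z2 u2 mu2 ->
        KKT P z0 (m' + n) (concat_states m' z1 z2) (concat_seq m' u1 u2)
          (concat_multipliers m' mu1 mu2)].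
Proof.
have n1 : (1 <= n)%N by lia.
have m'm1 : (m' < m)%N by lia.
split.
- exact: KKT_exists hopt1 (hMFCQ _ _ _ _ hopt1).
- exact: KKT_exists hopt2 (hMFCQ _ _ _ _ hopt2).
move=> mu1 mu2 K1 K2.
have [ob2 G2neg] := hz2 1%N htau.
apply: (KKT_concat hf hQ0 _ _ _ K1 K2) => //.
(* The window starts at [p = m'] in the first cycle and at [p = 1] in the second, so the
   reachability matrices have indices [m' + tau - 1] and [tau], both at least [tau]. *)
- by apply: (KKT_costate_eq0 hf hQ0 hr K1 htau); rewrite ?hC1//; lia.
- apply: (KKT_costate_eq0 hf hQ0 hr K2 htau); rewrite ?add1n ?subn1//=.
    by move=> i i1; apply: hz2; lia.
  by apply: hC2; lia.
- by apply: (state_force_eq0 hr K2 _ ob2 G2neg).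
Qed.
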